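(* For $|q|<1$, \begin{align*} \sum_{i,j,k\geq 0} \frac{q^{4i^2+\frac{3}{2}j^2+\frac{1}{2}k^2+4ij+ik-\frac{1}{2}j+\frac{1}{2}k}}{(q;q)_i(q;q)_j(q;q)_k} &=\frac{(-q;q)_\infty}{(q,q^4;q^5)_\infty}, \\ \sum_{i,j,k\geq 0} \frac{q^{4i^2+\frac{3}{2}j^2+\frac{1}{2}k^2+4ij+ik+2i+\frac{1}{2}j+\frac{1}{2}k}}{(q;q)_i(q;q)_j(q;q)_k} &=\frac{(-q;q)_\infty}{(q^2,q^3;q^5)_\infty}. \end{align*}
   Context: For $|q|<1$: $(a;q)_n=\prod_{k=0}^{n-1}(1-aq^k)$ ($(a;q)_0=1$), $(a;q)_\infty=\prod_{k\ge0}(1-aq^k)$, $(a_1,\dots,a_m;q)_\infty=\prod_\ell(a_\ell;q)_\infty$. Half-integer powers of $q$ use a fixed choice of $q^{1/2}$ (e.g. $0<q<1$). *)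

(* Defs.v *)
From Stdlib Require Import Reals Arith.
From Coquelicot Require Import Coquelicot.

Fixpoint qpoch (a q : C) (n : nat) : C :=
  match n with
  | O => 1%C
  | S m => Cmult (qpoch a q m) (Cminus 1%C (Cmult a (pow_n q m)))
  end.

Definition qpoch_inf (a q : C) : C :=
  @lim C_CompleteNormedModule (filtermap (fun n => qpoch a q n) eventually).

Definition cube_psum (f : nat -> nat -> nat -> C) (N : nat) : C :=
  sum_n (fun i => sum_n (fun j => sum_n (fun k => f i j k) N) N) N.

Definition triple_series_to (f : nat -> nat -> nat -> C) (s : C) : Prop :=
  filterlim (cube_psum f) eventually (locally s).

(* Exponents: 2*(4i^2+3/2 j^2+1/2 k^2+4ij+ik-1/2 j+1/2 k) is an even natural
   number, so the exponent is its half. *)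
Definition e1 (i j k : nat) : nat :=
  (8*i*i + 3*j*j + k*k + 8*i*j + 2*i*k + k - j) / 2.
Definition e2 (i j k : nat) : nat :=
  (8*i*i + 3*j*j + k*k + 8*i*j + 2*i*k + 4*i + j + k) / 2.

(* Main.v *)
(** The sum over [k] is Euler's [(-q^{i+1};q)_oo = (-q;q)_oo / (-q;q)_i], and the
    sum over [2i + j = m] collapses to [1 / (q;q)_m] because
    [(-z;q)_oo / (z^2;q^2)_oo = 1 / (z;q)_oo], which leaves [(-q;q)_oo] times the
    Rogers-Ramanujan sum [sum_m q^{m^2+cm} / (q;q)_m], with [c = 0] resp. [c = 1].
    All of this is done on truncated sums: multiplying the summand by a weight
    which tends to [1] turns the cubic partial sum into the finite
    Rogers-Ramanujan identity obtained from two Bailey steps, whose right-hand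
    side has numerators [(-1)^r q^{r(5r-1)/2}], resp. [(-1)^r q^{r(5r+3)/2}], and
    kernel [1 / ((q;q)_{N-r} (q;q)_{N+r+c})]. These numerators are also those of
    the finite Jacobi triple product in base [q^5]; replacing the kernel by the
    one in base [q^5] is harmless in the limit by dominated convergence, and the
    triple product gives the value. *)

Require Import Defs.
From Stdlib Require Import Reals Arith Lia Lra.
From Coquelicot Require Import Coquelicot.

Local Open Scope C_scope.

(** * Finite sums of complex numbers *)

Fixpoint csum (f : nat -> C) (n : nat) : C :=
  match n with
  | O => 0
  | S m => csum f m + f m
  end.

Lemma csum_ext (f g : nat -> C) (n : nat) :
  (forall k, (k < n)%nat -> f k = g k) -> csum f n = csum g n.
Proof.
induction n as [|n IH]; intros H; simpl; [reflexivity|].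
rewrite IH, H; auto.
Qed.

Lemma csum_plus (f g : nat -> C) (n : nat) :
  csum (fun k => f k + g k) n = csum f n + csum g n.
Proof. induction n as [|n IH]; simpl; [ring|]. rewrite IH; ring. Qed.

Lemma csum_minus (f g : nat -> C) (n : nat) :
  csum (fun k => f k - g k) n = csum f n - csum g n.
Proof. induction n as [|n IH]; simpl; [ring|]. rewrite IH; ring. Qed.

Lemma csum_scal (a : C) (f : nat -> C) (n : nat) :
  csum (fun k => a * f k) n = a * csum f n.
Proof. induction n as [|n IH]; simpl; [ring|]. rewrite IH; ring. Qed.

Lemma csum_0 (f : nat -> C) (n : nat) :
  (forall k, (k < n)%nat -> f k = 0) -> csum f n = 0.
Proof.
induction n as [|n IH]; intros H; simpl; [reflexivity|].
rewrite IH, H; auto; ring.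
Qed.

Lemma csum_add (f : nat -> C) (m n : nat) :
  csum f (m + n) = csum f m + csum (fun k => f (m + k)%nat) n.
Proof.
induction n as [|n IH]; simpl; [rewrite Nat.add_0_r; ring|].
rewrite Nat.add_succ_r; simpl; rewrite IH; ring.
Qed.

Lemma csum_shift (f : nat -> C) (n : nat) :
  csum f (S n) = f O + csum (fun k => f (S k)) n.
Proof.
change (S n) with (1 + n)%nat; rewrite csum_add; simpl; ring.
Qed.

Lemma csum_trunc (f : nat -> C) (m n : nat) :
  (m <= n)%nat -> (forall k, (m <= k < n)%nat -> f k = 0) ->
  csum f n = csum f m.
Proof.
intros Hmn H; replace n with (m + (n - m))%nat by lia.
rewrite csum_add, (csum_0 (fun k => f (m + k)%nat)); [ring|].
intros k Hk; apply H; lia.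
Qed.

Lemma csum_exchange (f : nat -> nat -> C) (m n : nat) :
  csum (fun i => csum (fun j => f i j) n) m
  = csum (fun j => csum (fun i => f i j) m) n.
Proof.
induction m as [|m IH]; simpl; [rewrite csum_0; auto|].
rewrite IH, <- csum_plus; reflexivity.
Qed.

(** * Inverse q-factorials and the q-Vandermonde sum *)

Definition no_root_of_unity (q : C) : Prop := forall n, 1 - q ^ S n <> 0.

Definition inv_qfact (q : C) (n : nat) : C := / qpoch q q n.

(** The convention 1/(q;q)_{-n} = 0 for n > 0, made explicit because truncated subtraction would
    give 1/(q;q)_0 = 1. It lets sums run past their natural range. *)
Definition inv_qfact_sub (q : C) (N r : nat) : C :=
  if Nat.leb r N then inv_qfact q (N - r) else 0.

Lemma pow_n_Cpow (q : C) (n : nat) : pow_n q n = q ^ n.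
Proof. induction n as [|n IH]; simpl; [|rewrite IH]; reflexivity. Qed.

Lemma qpoch_S (a q : C) (n : nat) :
  qpoch a q (S n) = qpoch a q n * (1 - a * q ^ n).
Proof. simpl; rewrite pow_n_Cpow; reflexivity. Qed.

Lemma qpoch_neq_0 (a q : C) (n : nat) :
  (forall k, 1 - a * q ^ k <> 0) -> qpoch a q n <> 0.
Proof.
intros H; induction n as [|n IH]; [apply C1_nz|].
rewrite qpoch_S; apply Cmult_neq_0; auto.
Qed.

Lemma qfact_neq_0 (q : C) (n : nat) : no_root_of_unity q -> qpoch q q n <> 0.
Proof. intros H; apply qpoch_neq_0; intros k; exact (H k). Qed.

Lemma inv_qfact_0 (q : C) : inv_qfact q 0 = 1.
Proof. unfold inv_qfact; simpl; field. Qed.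

Lemma inv_qfact_S (q : C) (n : nat) :
  no_root_of_unity q -> (1 - q ^ S n) * inv_qfact q (S n) = inv_qfact q n.
Proof.
intros H; unfold inv_qfact; rewrite qpoch_S.
change (q * q ^ n) with (q ^ S n).
field; split; [apply qfact_neq_0, H | apply H].
Qed.

Lemma inv_qfact_sub_le (q : C) (N r : nat) :
  (r <= N)%nat -> inv_qfact_sub q N r = inv_qfact q (N - r).
Proof. intros H; unfold inv_qfact_sub; apply Nat.leb_le in H; rewrite H; auto. Qed.

Lemma inv_qfact_sub_gt (q : C) (N r : nat) :
  (N < r)%nat -> inv_qfact_sub q N r = 0.
Proof. intros H; unfold inv_qfact_sub; apply Nat.leb_gt in H; rewrite H; auto. Qed.

Lemma inv_qfact_sub_add (q : C) (N r m : nat) :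
  inv_qfact_sub q (r + N) (r + m) = inv_qfact_sub q N m.
Proof.
destruct (le_gt_dec m N) as [H|H].
- rewrite !inv_qfact_sub_le by lia; f_equal; lia.
- rewrite !inv_qfact_sub_gt by lia; auto.
Qed.

Lemma inv_qfact_sub_SS (q : C) (N r : nat) :
  inv_qfact_sub q (S N) (S r) = inv_qfact_sub q N r.
Proof. exact (inv_qfact_sub_add q N 1 r). Qed.

Lemma inv_qfact_sub_0 (q : C) (N : nat) : inv_qfact_sub q N 0 = inv_qfact q N.
Proof. rewrite inv_qfact_sub_le by lia; f_equal; lia. Qed.

Lemma inv_qfact_sub_S (q : C) (N r : nat) :
  no_root_of_unity q ->
  (1 - q ^ (S N - r)) * inv_qfact_sub q (S N) r = inv_qfact_sub q N r.
Proof.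
intros H; destruct (le_gt_dec r N) as [Hr|Hr].
- rewrite !inv_qfact_sub_le by lia.
  replace (S N - r)%nat with (S (N - r)) by lia; apply inv_qfact_S, H.
- rewrite (inv_qfact_sub_gt q N) by lia.
  replace (S N - r)%nat with O by lia; simpl; ring.
Qed.

(** A form of the q-Pascal rule, from 1 - q^{N+1} = (1 - q^{N+1-r}) + q^{N+1-r} (1 - q^r); it drives
    the inductions for the q-Vandermonde and q-binomial sums. *)
Lemma inv_qfact_sub_split (q : C) (N r : nat) :
  no_root_of_unity q -> (r <= S N)%nat ->
  (1 - q ^ S N) * inv_qfact_sub q (S N) r
  = inv_qfact_sub q N r + q ^ (S N - r) * (1 - q ^ r) * inv_qfact_sub q (S N) r.
Proof.
intros H Hr; rewrite <- (inv_qfact_sub_S q N r H).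
replace (q ^ S N) with (q ^ (S N - r) * q ^ r); [ring|].
rewrite <- Cpow_add_r; f_equal; lia.
Qed.

Lemma Cmult_cancel_l (a x y : C) : a <> 0 -> a * x = a * y -> x = y.
Proof.
intros Ha H; replace x with (/ a * (a * x)) by (field; auto).
rewrite H; field; auto.
Qed.

(** Induction on M for all d at once: after splitting, the first sum is the case (M, d), and the
    second, shifted by one, is q^{M+1+d} times the case (M, d+1). *)
Lemma qvandermonde (q : C) (M d : nat) :
  no_root_of_unity q ->
  csum (fun m => q ^ (m * m + d * m) * inv_qfact_sub q M m * inv_qfact q m
                 * inv_qfact q (m + d)) (S M)
  = inv_qfact q M * inv_qfact q (M + d).
Proof.
intros H; revert d; induction M as [|M IH]; intros d.
{ simpl; rewrite Nat.mul_0_r, inv_qfact_sub_0, inv_qfact_0; simpl; ring. }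
apply (Cmult_cancel_l (1 - q ^ S M)); [apply H|].
rewrite <- csum_scal.
rewrite (csum_ext _ (fun m =>
  q ^ (m * m + d * m) * inv_qfact_sub q M m * inv_qfact q m * inv_qfact q (m + d)
  + q ^ (m * m + d * m) * q ^ (S M - m) * inv_qfact_sub q (S M) m
    * ((1 - q ^ m) * inv_qfact q m) * inv_qfact q (m + d))).
2:{ intros m Hm.
  transitivity (q ^ (m * m + d * m) * inv_qfact q m * inv_qfact q (m + d)
     * ((1 - q ^ S M) * inv_qfact_sub q (S M) m)); [ring|].
  rewrite inv_qfact_sub_split by (auto; lia); ring. }
rewrite csum_plus.
rewrite (csum_trunc _ (S M)) by
  (try lia; intros k Hk; rewrite inv_qfact_sub_gt by lia; ring).
rewrite IH, csum_shift.
rewrite (csum_ext (fun k => _ * ((1 - q ^ S k) * inv_qfact q (S k)) * _) (fun m =>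
  q ^ (S M + d) *
  (q ^ (m * m + S d * m) * inv_qfact_sub q M m * inv_qfact q m
   * inv_qfact q (m + S d)))).
2:{ intros m Hm; rewrite inv_qfact_S, inv_qfact_sub_SS by auto.
  replace (S m + d)%nat with (m + S d)%nat by lia.
  replace (q ^ (S m * S m + d * S m) * q ^ (S M - S m))
    with (q ^ (S M + d) * q ^ (m * m + S d * m)); [ring|].
  rewrite <- !Cpow_add_r; f_equal; nia. }
rewrite csum_scal, IH.
replace (M + S d)%nat with (S M + d)%nat by lia.
rewrite <- (inv_qfact_S q (M + d) H).
change (S (M + d)) with (S M + d)%nat.
rewrite <- (inv_qfact_S q M H); simpl; ring.
Qed.

(** * Bailey pairs and the finite Jacobi triple product *)

(** Bailey pair relative to a = q^c. The denominator has (q;q)_{n+r+c} instead of (aq;q)_{n+r}, so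
    beta is the usual one divided by (q;q)_c. *)
Definition bailey_beta (q : C) (c : nat) (alpha : nat -> C) (n : nat) : C :=
  csum (fun r => alpha r * inv_qfact_sub q n r * inv_qfact q (n + r + c)) (S n).

(** Bailey's lemma with both free parameters sent to infinity. After exchanging the sums and putting
    n = r + m, the inner sum is q-Vandermonde with M = N - r and d = 2r + c. *)
Lemma bailey_lemma (q : C) (c : nat) (alpha : nat -> C) (N : nat) :
  no_root_of_unity q ->
  csum (fun n => q ^ (n * n + c * n) * inv_qfact_sub q N n
                 * bailey_beta q c alpha n) (S N)
  = bailey_beta q c (fun r => q ^ (r * r + c * r) * alpha r) N.
Proof.
intros H.
rewrite (csum_ext _ (fun n => csum (fun r =>
   q ^ (n * n + c * n) * inv_qfact_sub q N n
   * (alpha r * inv_qfact_sub q n r * inv_qfact q (n + r + c))) (S N))).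
2:{ intros n Hn; unfold bailey_beta; rewrite <- csum_scal.
  symmetry; apply csum_trunc; [lia|].
  intros k Hk; rewrite (inv_qfact_sub_gt q n k) by lia; ring. }
rewrite csum_exchange; apply csum_ext; intros r Hr.
replace (S N) with (r + S (N - r))%nat by lia.
rewrite csum_add, csum_0.
2:{ intros k Hk; rewrite (inv_qfact_sub_gt q k r) by lia; ring. }
rewrite (csum_ext _ (fun m => q ^ (r * r + c * r) * alpha r *
   (q ^ (m * m + (2 * r + c) * m) * inv_qfact_sub q (N - r) m
    * inv_qfact q m * inv_qfact q (m + (2 * r + c))))).
2:{ intros m Hm.
  replace N with (r + (N - r))%nat at 1 by lia.
  rewrite inv_qfact_sub_add, (inv_qfact_sub_le q (r + m) r) by lia.
  replace (r + m - r)%nat with m by lia.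
  replace (r + m + r + c)%nat with (m + (2 * r + c))%nat by lia.
  replace (q ^ ((r + m) * (r + m) + c * (r + m)))
    with (q ^ (r * r + c * r) * q ^ (m * m + (2 * r + c) * m)); [ring|].
  rewrite <- Cpow_add_r; f_equal; nia. }
rewrite csum_scal, qvandermonde, (inv_qfact_sub_le q N r) by (auto; lia).
replace (N - r + (2 * r + c))%nat with (N + r + c)%nat by lia; ring.
Qed.

(** Equals (-x)^r p^{r(r-1)/2}; the recursion avoids halving an exponent. *)
Fixpoint theta_coef (x p : C) (r : nat) : C :=
  match r with
  | O => 1
  | S s => - x * p ^ s * theta_coef x p s
  end.

(** Finite q-binomial theorem. Splitting leaves the sum for N and, after a shift, -x q^N times the
    same sum, which together give the new factor 1 - x q^N. *)
Lemma qbinomial (x q : C) (N : nat) :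
  no_root_of_unity q ->
  csum (fun n => theta_coef x q n * inv_qfact q n * inv_qfact_sub q N n) (S N)
  = qpoch x q N * inv_qfact q N.
Proof.
intros H; induction N as [|N IH].
{ simpl; rewrite inv_qfact_sub_0, inv_qfact_0; ring. }
apply (Cmult_cancel_l (1 - q ^ S N)); [apply H|].
rewrite <- csum_scal.
rewrite (csum_ext _ (fun n =>
  theta_coef x q n * inv_qfact q n * inv_qfact_sub q N n
  + theta_coef x q n * q ^ (S N - n) * inv_qfact_sub q (S N) n
    * ((1 - q ^ n) * inv_qfact q n))).
2:{ intros n Hn.
  transitivity (theta_coef x q n * inv_qfact q n
     * ((1 - q ^ S N) * inv_qfact_sub q (S N) n)); [ring|].
  rewrite inv_qfact_sub_split by (auto; lia); ring. }
rewrite csum_plus, (csum_trunc _ (S N)) by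
  (try lia; intros k Hk; rewrite inv_qfact_sub_gt by lia; ring).
rewrite IH, csum_shift.
rewrite (csum_ext (fun k => _ * ((1 - q ^ S k) * inv_qfact q (S k))) (fun n =>
  (- x * q ^ N) * (theta_coef x q n * inv_qfact q n * inv_qfact_sub q N n))).
2:{ intros n Hn; rewrite inv_qfact_S, inv_qfact_sub_SS by auto.
  replace (q ^ N) with (q ^ n * q ^ (S N - S n)); [simpl; ring|].
  rewrite <- Cpow_add_r; f_equal; lia. }
rewrite csum_scal, IH, qpoch_S.
rewrite <- (inv_qfact_S q N H); simpl; ring.
Qed.

(** The two-sided sum of the finite Jacobi triple product, folded onto [r >= 0]:
    the terms [r] and [- r] (for [c = 0]), resp. [r] and [- r - 1] (for [c = 1]),
    have the same denominator; [c] is only meant to be [0] or [1]. *)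
Definition jacobi_alpha (c : nat) (x y p : C) (r : nat) : C :=
  match c, r with
  | O, O => 1
  | _, _ => theta_coef x p r + theta_coef y p (r + c)
  end.

Lemma theta_coef_step (x y p : C) (N r : nat) :
  x * y = p ->
  p ^ (N + S r) * theta_coef x p r = - y * p ^ N * theta_coef x p (S r).
Proof. intros H; rewrite Cpow_add_r; simpl. rewrite <- H at 2; ring. Qed.

Lemma jacobi_alpha_eq_0 (x y p : C) (N : nat) :
  bailey_beta p 0 (jacobi_alpha 0 x y p) N
  = csum (fun r => theta_coef x p r * inv_qfact_sub p N r * inv_qfact p (N + r)) (S N)
  + csum (fun r => theta_coef y p (S r) * inv_qfact_sub p N (S r)
                   * inv_qfact p (N + S r)) N.
Proof.
unfold bailey_beta; rewrite !csum_shift.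
rewrite (csum_ext (fun k => jacobi_alpha 0 x y p (S k) * _ * _)
  (fun r => theta_coef x p (S r) * inv_qfact_sub p N (S r) * inv_qfact p (N + S r)
  + theta_coef y p (S r) * inv_qfact_sub p N (S r) * inv_qfact p (N + S r))).
2:{ intros k Hk; unfold jacobi_alpha; rewrite !Nat.add_0_r; ring. }
rewrite csum_plus, Nat.add_0_r; simpl; ring.
Qed.

Lemma jacobi_alpha_eq_1 (x y p : C) (N : nat) :
  bailey_beta p 1 (jacobi_alpha 1 x y p) N
  = csum (fun r => theta_coef x p r * inv_qfact_sub p N r * inv_qfact p (N + S r)) (S N)
  + csum (fun r => theta_coef y p (S r) * inv_qfact_sub p N r
                   * inv_qfact p (N + S r)) (S N).
Proof.
unfold bailey_beta; rewrite <- csum_plus; apply csum_ext; intros r Hr.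
unfold jacobi_alpha; rewrite Nat.add_1_r.
replace (N + r + 1)%nat with (N + S r)%nat by lia; ring.
Qed.

(** Adds the factor 1 - y p^N to the finite triple product. On the [x] half, 1 - p^{2N+1} = (1 -
    p^{N+r+1}) + p^{N+r+1} (1 - p^{N-r}); on the [y] half the two exponents change places. *)
Lemma jacobi_step_01 (x y p : C) (N : nat) :
  no_root_of_unity p -> x * y = p ->
  (1 - p ^ S (2 * N)) * bailey_beta p 1 (jacobi_alpha 1 x y p) N
  = (1 - y * p ^ N) * bailey_beta p 0 (jacobi_alpha 0 x y p) N.
Proof.
intros H Hxy; rewrite jacobi_alpha_eq_0, jacobi_alpha_eq_1.
rewrite Cmult_plus_distr_l, <- !csum_scal.
rewrite (csum_ext _ (fun r =>
   theta_coef x p r * inv_qfact_sub p N r * inv_qfact p (N + r)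
   + - y * p ^ N * (theta_coef x p (S r) * inv_qfact_sub p N (S r)
                    * inv_qfact p (N + S r)))).
2:{ intros r Hr.
  rewrite <- (inv_qfact_S p (N + r) H).
  rewrite <- (inv_qfact_sub_SS p N r), <- (inv_qfact_sub_S p N (S r) H).
  change (S N - S r)%nat with (N - r)%nat.
  replace (S (N + r)) with (N + S r)%nat by lia.
  transitivity (inv_qfact_sub p (S N) (S r) * inv_qfact p (N + S r) *
   ((1 - p ^ (N + S r)) * theta_coef x p r
   + (1 - p ^ (N - r)) * (- y * p ^ N * theta_coef x p (S r)))); [|ring].
  rewrite <- (theta_coef_step x y p N r Hxy).
  replace (p ^ S (2 * N)) with (p ^ (N + S r) * p ^ (N - r)); [ring|].
  rewrite <- Cpow_add_r; f_equal; lia. }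
rewrite csum_plus.
rewrite (csum_ext (fun k => (1 - p ^ S (2 * N)) * (theta_coef y p (S k) * _ * _)) (fun r =>
   theta_coef y p (S r) * inv_qfact_sub p N (S r) * inv_qfact p (N + S r)
   + - y * p ^ N * (theta_coef y p r * inv_qfact_sub p N r * inv_qfact p (N + r)))).
2:{ intros r Hr.
  rewrite <- (inv_qfact_S p (N + r) H).
  rewrite <- (inv_qfact_sub_SS p N r), <- (inv_qfact_sub_S p N (S r) H).
  change (S N - S r)%nat with (N - r)%nat.
  replace (S (N + r)) with (N + S r)%nat by lia.
  replace (p ^ S (2 * N)) with (p ^ (N + S r) * p ^ (N - r))
    by (rewrite <- Cpow_add_r; f_equal; lia).
  replace (p ^ N) with (p ^ (N - r) * p ^ r)
    by (rewrite <- Cpow_add_r; f_equal; lia).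
  simpl theta_coef; ring. }
rewrite csum_plus, !csum_scal.
(* With the factor -y p^N, index 0 is missing from the shifted [x] half; the [y] half supplies it,
   both coefficients being 1 there. *)
rewrite (csum_shift (fun r => theta_coef x p r * inv_qfact_sub p N r * _) N) at 2.
rewrite (csum_shift (fun r => theta_coef y p r * inv_qfact_sub p N r * _) N).
rewrite (csum_trunc (fun r => theta_coef x p (S r) * _ * _) N (S N)),
  (csum_trunc (fun r => theta_coef y p (S r) * _ * _) N (S N)) by
  (try lia; intros k Hk; rewrite inv_qfact_sub_gt by lia; ring).
rewrite csum_shift; simpl theta_coef; ring.
Qed.

(** Adds the factor 1 - x p^N by splitting 1 - p^{2N+2} in the same way, the two halves exchanging
    their roles. *)
Lemma jacobi_step_10 (x y p : C) (N : nat) :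
  no_root_of_unity p -> x * y = p ->
  (1 - p ^ S (S (2 * N))) * bailey_beta p 0 (jacobi_alpha 0 x y p) (S N)
  = (1 - x * p ^ N) * bailey_beta p 1 (jacobi_alpha 1 x y p) N.
Proof.
intros H Hxy; rewrite jacobi_alpha_eq_0, jacobi_alpha_eq_1.
rewrite Cmult_plus_distr_l, <- !csum_scal.
rewrite (csum_ext _ (fun r =>
   theta_coef x p r * inv_qfact_sub p N r * inv_qfact p (N + S r)
   + theta_coef x p r * p ^ (S N - r) * inv_qfact_sub p (S N) r * inv_qfact p (N + r))).
2:{ intros r Hr.
  rewrite <- (inv_qfact_S p (N + r) H), <- (inv_qfact_sub_S p N r H).
  replace (S (N + r)) with (N + S r)%nat by lia.
  replace (S N + r)%nat with (N + S r)%nat by lia.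
  replace (p ^ S (S (2 * N))) with (p ^ (N + S r) * p ^ (S N - r))
    by (rewrite <- Cpow_add_r; f_equal; lia).
  ring. }
rewrite csum_plus.
rewrite (csum_ext (fun k => (1 - p ^ S (S (2 * N))) * (theta_coef y p (S k) * _ * _)) (fun r =>
   theta_coef y p (S r) * inv_qfact_sub p N r * inv_qfact p (N + S r)
   + - x * p ^ N * (theta_coef y p (S (S r)) * inv_qfact_sub p N (S r)
                    * inv_qfact p (N + S (S r))))).
2:{ intros r Hr.
  rewrite inv_qfact_sub_SS.
  rewrite <- (inv_qfact_S p (N + S r) H), <- (inv_qfact_sub_SS p N r),
    <- (inv_qfact_sub_S p N (S r) H).
  change (S N - S r)%nat with (N - r)%nat.
  replace (S (N + S r)) with (N + S (S r))%nat by lia.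
  replace (S N + S r)%nat with (N + S (S r))%nat by lia.
  transitivity (inv_qfact_sub p (S N) (S r) * inv_qfact p (N + S (S r)) *
   ((1 - p ^ (N + S (S r))) * theta_coef y p (S r)
   + (1 - p ^ (N - r)) * (- x * p ^ N * theta_coef y p (S (S r))))); [|ring].
  rewrite <- (theta_coef_step y x p N (S r)) by (rewrite <- Hxy; ring).
  replace (p ^ S (S (2 * N))) with (p ^ (N + S (S r)) * p ^ (N - r)); [ring|].
  rewrite <- Cpow_add_r; f_equal; lia. }
rewrite csum_plus, !csum_scal.
rewrite (csum_trunc _ (S N) (S (S N))) by
  (try lia; intros k Hk; rewrite inv_qfact_sub_gt by lia; ring).
rewrite (csum_shift (fun r => theta_coef x p r * _ * _ * _) (S N)).
rewrite (csum_ext (fun k => theta_coef x p (S k) * _ * _ * _) (fun r =>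
   - x * p ^ N * (theta_coef x p r * inv_qfact_sub p N r * inv_qfact p (N + S r)))).
2:{ intros r Hr; rewrite inv_qfact_sub_SS.
  replace (p ^ N) with (p ^ r * p ^ (S N - S r))
    by (rewrite <- Cpow_add_r; f_equal; lia).
  simpl theta_coef; ring. }
rewrite csum_scal.
rewrite (csum_trunc (fun r => theta_coef y p (S (S r)) * _ * _) N (S N)) by
  (try lia; intros k Hk; rewrite inv_qfact_sub_gt by lia; ring).
rewrite (csum_shift (fun r => theta_coef y p (S r) * _ * _) N).
rewrite !inv_qfact_sub_0, Nat.add_0_r, Nat.add_1_r, Nat.sub_0_r.
rewrite <- (inv_qfact_S p N H).
(* At index 0 the [x] half leaves p^{N+1} = (-x p^N)(-y), and -y is the coefficient of index 1 in
   the [y] half. *)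
replace (p ^ S N) with (x * y * p ^ N) by (rewrite Hxy; reflexivity).
simpl; ring.
Qed.

(** The products have 2N and 2N + 1 factors; the induction adds one factor at a time, alternating
    between the two forms. *)
Lemma finite_jacobi (x y p : C) (N : nat) :
  no_root_of_unity p -> x * y = p ->
  bailey_beta p 0 (jacobi_alpha 0 x y p) N
  = qpoch x p N * qpoch y p N * inv_qfact p (2 * N) /\
  bailey_beta p 1 (jacobi_alpha 1 x y p) N
  = qpoch x p N * qpoch y p (S N) * inv_qfact p (S (2 * N)).
Proof.
intros H Hxy.
assert (step : forall n,
  bailey_beta p 0 (jacobi_alpha 0 x y p) n
  = qpoch x p n * qpoch y p n * inv_qfact p (2 * n) ->
  bailey_beta p 1 (jacobi_alpha 1 x y p) n
  = qpoch x p n * qpoch y p (S n) * inv_qfact p (S (2 * n))).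
{ intros n Hn; apply (Cmult_cancel_l (1 - p ^ S (2 * n))); [apply H|].
  rewrite (jacobi_step_01 x y p n H Hxy), Hn, qpoch_S.
  rewrite <- (inv_qfact_S p (2 * n) H); ring. }
induction N as [|N [_ IH]].
- assert (E : bailey_beta p 0 (jacobi_alpha 0 x y p) 0
    = qpoch x p 0 * qpoch y p 0 * inv_qfact p (2 * 0)).
  { unfold bailey_beta; simpl; rewrite inv_qfact_sub_0, inv_qfact_0; ring. }
  auto.
- assert (E : bailey_beta p 0 (jacobi_alpha 0 x y p) (S N)
    = qpoch x p (S N) * qpoch y p (S N) * inv_qfact p (2 * S N)).
  { replace (2 * S N)%nat with (S (S (2 * N))) by lia.
    apply (Cmult_cancel_l (1 - p ^ S (S (2 * N)))); [apply H|].
    rewrite (jacobi_step_10 x y p N H Hxy), IH, (qpoch_S x).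
    rewrite <- (inv_qfact_S p (S (2 * N)) H); ring. }
  auto.
Qed.

(** * The unit Bailey pair and the finite Rogers-Ramanujan identities *)

Lemma qpoch_1 (q : C) (n : nat) : qpoch 1 q (S n) = 0.
Proof.
induction n as [|n IH]; rewrite qpoch_S; [simpl; ring|].
rewrite IH; ring.
Qed.

Lemma bailey_beta_ext (q : C) (c : nat) (alpha alpha' : nat -> C) (n : nat) :
  (forall r, alpha r = alpha' r) ->
  bailey_beta q c alpha n = bailey_beta q c alpha' n.
Proof. intros E; apply csum_ext; intros r _; rewrite E; reflexivity. Qed.

(** The finite triple product at x = 1, y = q, where (1;q)_n contains the factor 1 - 1 once n >=
    1. *)
Lemma unit_bailey_pair (q : C) (c n : nat) :
  no_root_of_unity q -> (c <= 1)%nat ->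
  bailey_beta q c (jacobi_alpha c 1 q q) n = match n with O => 1 | S _ => 0 end.
Proof.
intros H Hc.
destruct (finite_jacobi 1 q q n H) as [H0 H1]; [ring|].
assert (c = 0 \/ c = 1)%nat as [-> | ->] by lia.
- rewrite H0; destruct n; [simpl; rewrite inv_qfact_0; ring|].
  rewrite qpoch_1; ring.
- rewrite H1; destruct n; [|rewrite qpoch_1; ring].
  rewrite qpoch_S; simpl Nat.mul.
  transitivity ((1 - q ^ 1) * inv_qfact q 1); [simpl; ring|].
  rewrite inv_qfact_S, inv_qfact_0; auto.
Qed.

(** The Bailey lemma applied twice to the unit Bailey pair. *)
Lemma finite_rogers_ramanujan (q : C) (c N : nat) :
  no_root_of_unity q -> (c <= 1)%nat ->
  csum (fun n => q ^ (n * n + c * n) * inv_qfact_sub q N n * inv_qfact q n) (S N)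
  = bailey_beta q c (fun r => q ^ (r * r + c * r) *
      (q ^ (r * r + c * r) * jacobi_alpha c 1 q q r)) N.
Proof.
intros H Hc; rewrite <- bailey_lemma by exact H.
apply csum_ext; intros n _; f_equal.
rewrite <- bailey_lemma by exact H.
(* In the first Bailey step only index 0 of the unit pair survives, which leaves beta_n =
   1/(q;q)_n. *)
rewrite csum_shift, csum_0.
- rewrite unit_bailey_pair, inv_qfact_sub_0, !Nat.mul_0_r by auto; simpl; ring.
- intros k _; rewrite unit_bailey_pair by auto; ring.
Qed.

(** * Passage from base q to base q^5 *)

(** Since 2r^2 is four times r(r-1)/2 plus 2r, the quadratic exponent becomes five times as large
    and [x] picks up q^{2+m}. *)
Lemma theta_coef_base (x q : C) (m r : nat) :
  q ^ (2 * (r * r) + m * r) * theta_coef x q r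
  = theta_coef (x * q ^ (2 + m)) (q ^ 5) r.
Proof.
induction r as [|r IH]; [rewrite !Nat.mul_0_r; simpl; ring|].
cbn [theta_coef]; rewrite <- IH, <- Cpow_mult_r.
replace (2 * (S r * S r) + m * S r)%nat
  with ((2 + m) + (4 * r + (2 * (r * r) + m * r)))%nat by lia.
replace (5 * r)%nat with (r + 4 * r)%nat by lia.
rewrite !(Cpow_add_r q); ring.
Qed.

(** Here 2r(r+1) is exactly four times r(r+1)/2, the quadratic exponent at index r + 1, so only the
    base changes. *)
Lemma theta_coef_base_neg (q : C) (r : nat) :
  q ^ (2 * (r * r) + 2 * r) * theta_coef q q (S r)
  = theta_coef q (q ^ 5) (S r).
Proof.
induction r as [|r IH]; [simpl; ring|].
transitivity (- q * q ^ (4 * S r) * q ^ S r *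
  (q ^ (2 * (r * r) + 2 * r) * theta_coef q q (S r))).
- replace (2 * (S r * S r) + 2 * S r)%nat
    with (4 * S r + (2 * (r * r) + 2 * r))%nat by lia.
  rewrite (Cpow_add_r q (4 * S r)); cbn [theta_coef]; ring.
- rewrite IH; change (theta_coef q (q ^ 5) (S (S r)))
    with (- q * (q ^ 5) ^ S r * theta_coef q (q ^ 5) (S r)).
  rewrite <- Cpow_mult_r; replace (5 * S r)%nat with (4 * S r + S r)%nat by lia.
  rewrite Cpow_add_r; ring.
Qed.

(** After two Bailey steps the numerators are those of the triple product for the residues 2 and 3
    modulo 5; for c = 1 the residues are 4 and 1. *)
Lemma jacobi_alpha_base_0 (q : C) (r : nat) :
  q ^ (r * r + 0 * r) * (q ^ (r * r + 0 * r) * jacobi_alpha 0 1 q q r)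
  = jacobi_alpha 0 (q ^ 2) (q ^ 3) (q ^ 5) r.
Proof.
rewrite Cmult_assoc, <- Cpow_add_r.
replace (r * r + 0 * r + (r * r + 0 * r))%nat
  with (2 * (r * r) + 0 * r)%nat by lia.
destruct r as [|r]; [simpl; ring|].
unfold jacobi_alpha; rewrite (Nat.add_0_r (S r)), Cmult_plus_distr_l, !theta_coef_base.
f_equal; f_equal; simpl; ring.
Qed.

Lemma jacobi_alpha_base_1 (q : C) (r : nat) :
  q ^ (r * r + 1 * r) * (q ^ (r * r + 1 * r) * jacobi_alpha 1 1 q q r)
  = jacobi_alpha 1 (q ^ 4) q (q ^ 5) r.
Proof.
rewrite Cmult_assoc, <- Cpow_add_r.
replace (r * r + 1 * r + (r * r + 1 * r))%nat
  with (2 * (r * r) + 2 * r)%nat by lia.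
unfold jacobi_alpha; rewrite Nat.add_1_r, Cmult_plus_distr_l.
rewrite theta_coef_base, theta_coef_base_neg.
f_equal; f_equal; simpl; ring.
Qed.

(** * The triple sum *)

(** One factor of a convolution along 2i + j = m; set to 0 for 2i > m, where truncated subtraction
    would give [b 0]. *)
Definition conv_term (b : nat -> C) (m i : nat) : C :=
  if Nat.leb (2 * i) m then b (m - 2 * i)%nat else 0.

(** Sorts the square by m = 2i + j. Pairs with m > N leave the range of the right-hand side, and [g]
    vanishes there. *)
Lemma csum_diagonal (g a b : nat -> C) (N : nat) :
  (forall m, (N < m)%nat -> g m = 0) ->
  csum (fun i => csum (fun j => g (2 * i + j)%nat * a i * b j) (S N)) (S N)
  = csum (fun m => g m * csum (fun i => a i * conv_term b m i) (S N)) (S N).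
Proof.
intros Hg.
rewrite (csum_ext (fun m => g m * _)
  (fun m => csum (fun i => g m * (a i * conv_term b m i)) (S N)))
  by (intros m _; rewrite csum_scal; auto).
rewrite (csum_exchange (fun m i => g m * (a i * conv_term b m i))).
apply csum_ext; intros i Hi.
destruct (le_gt_dec (2 * i) N) as [H|H].
- rewrite (csum_trunc _ (S (N - 2 * i))) by
    (try lia; intros k Hk; rewrite Hg by lia; ring).
  replace (S N) with (2 * i + S (N - 2 * i))%nat by lia.
  rewrite csum_add, (csum_0 _ (2 * i)).
  + rewrite Cplus_0_l; apply csum_ext; intros j Hj; unfold conv_term.
    replace (Nat.leb (2 * i) (2 * i + j)) with true
      by (symmetry; apply Nat.leb_le; lia).
    replace (2 * i + j - 2 * i)%nat with j by lia; ring.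
  + intros k Hk; unfold conv_term.
    replace (Nat.leb (2 * i) k) with false
      by (symmetry; apply Nat.leb_gt; lia); ring.
- rewrite !csum_0; auto.
  + intros k Hk; unfold conv_term.
    replace (Nat.leb (2 * i) k) with false
      by (symmetry; apply Nat.leb_gt; lia); ring.
  + intros k Hk; rewrite Hg by lia; ring.
Qed.

(** Coefficient extraction in
    [(-z;q)_oo / (z^2;q^2)_oo = 1 / (z;q)_oo]. *)
Lemma euler_convolution (q : C) (a : nat -> C) (m n : nat) :
  no_root_of_unity q -> a O = 1 ->
  (forall i, (1 - q ^ (2 * S i)) * a (S i) = a i) ->
  (m <= n)%nat ->
  csum (fun i => a i * conv_term
    (fun j => theta_coef (- (1)) q j * inv_qfact q j) m i) (S n)
  = inv_qfact q m.
Proof.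
intros H Ha0 Ha.
(* [b] holds the coefficients of (-z;q)_oo and [b'] those of (-qz;q)_oo; [Hb] is (-z;q)_oo = (1 + z)
   (-qz;q)_oo. *)
set (b := fun j => theta_coef (- (1)) q j * inv_qfact q j).
set (b' := fun j => q ^ j * b j).
assert (Hb : forall j, b (S j) = b' (S j) + b' j).
{ intros j; unfold b', b; rewrite <- (inv_qfact_S q j H); simpl; ring. }
assert (Hc : forall k i,
  conv_term b (S k) i = conv_term b' (S k) i + conv_term b' k i).
{ intros k i; unfold conv_term.
  destruct (le_gt_dec (2 * i) k) as [Hi|Hi].
  - replace (Nat.leb (2 * i) (S k)) with true by (symmetry; apply Nat.leb_le; lia).
    replace (Nat.leb (2 * i) k) with true by (symmetry; apply Nat.leb_le; lia).
    replace (S k - 2 * i)%nat with (S (k - 2 * i)) by lia; apply Hb.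
  - replace (Nat.leb (2 * i) k) with false by (symmetry; apply Nat.leb_gt; lia).
    destruct (Nat.leb (2 * i) (S k)) eqn:E; [|ring].
    apply Nat.leb_le in E; replace (S k - 2 * i)%nat with O by lia.
    unfold b'; simpl; ring. }
assert (Hs : forall k i, conv_term b' (S (S k)) (S i) = conv_term b' k i).
{ intros k i; unfold conv_term.
  replace (2 * S i)%nat with (S (S (2 * i))) by lia; reflexivity. }
(* Let F(z) be (-z;q)_oo times the generating function of [a] in z^2. This prepares F(z) - F(qz),
   changing z to qz first in one factor, then in the other. *)
assert (Hd : forall k i, (1 - q ^ k) * conv_term b k i
  = conv_term b k i - conv_term b' k i + (1 - q ^ (2 * i)) * conv_term b' k i).
{ intros k i; unfold conv_term.
  destruct (Nat.leb (2 * i) k) eqn:E; [|ring].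
  apply Nat.leb_le in E; unfold b'.
  replace (q ^ k) with (q ^ (2 * i) * q ^ (k - 2 * i))
    by (rewrite <- Cpow_add_r; f_equal; lia); ring. }
revert n; induction m as [|m IH]; intros n Hmn.
{ rewrite csum_shift, csum_0, Ha0.
  - unfold conv_term, b; simpl; ring.
  - intros k _; unfold conv_term.
    replace (Nat.leb (2 * S k) 0) with false; [ring|].
    symmetry; apply Nat.leb_gt; lia. }
(* Coefficient of z^{m+1} in F(z) - F(qz) = z F(z), the q-difference equation of 1/(z;q)_oo. *)
apply (Cmult_cancel_l (1 - q ^ S m)); [apply H|].
rewrite inv_qfact_S, <- csum_scal by exact H.
rewrite (csum_ext _ (fun i => a i * conv_term b' m i
  + (1 - q ^ (2 * i)) * a i * conv_term b' (S m) i)).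
2:{ intros i _.
  transitivity (a i * ((1 - q ^ S m) * conv_term b (S m) i)); [ring|].
  rewrite Hd, Hc; ring. }
rewrite csum_plus, (csum_shift (fun i => (1 - q ^ (2 * i)) * a i * _)).
destruct m as [|m].
{ rewrite csum_shift, !csum_0.
  - rewrite Ha0, inv_qfact_0; unfold conv_term, b', b; simpl.
    rewrite inv_qfact_0; ring.
  - intros k _; unfold conv_term.
    replace (Nat.leb (2 * S k) 1) with false; [ring|].
    symmetry; apply Nat.leb_gt; lia.
  - intros k _; unfold conv_term.
    replace (Nat.leb (2 * S k) 0) with false; [ring|].
    symmetry; apply Nat.leb_gt; lia. }
rewrite <- (IH n) by lia.
rewrite (csum_ext (fun k => (1 - q ^ (2 * S k)) * _ * _)
  (fun i => a i * conv_term b' m i)) by (intros i _; rewrite Ha, Hs; auto).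
rewrite (csum_ext (fun i => a i * conv_term b (S m) i)
  (fun i => a i * conv_term b' (S m) i + a i * conv_term b' m i))
  by (intros i _; rewrite Hc; ring).
rewrite csum_plus, (csum_trunc (fun i => a i * conv_term b' m i) n (S n)); auto.
- simpl; ring.
- intros k Hk; unfold conv_term.
  replace (Nat.leb (2 * k) m) with false; [ring|].
  symmetry; apply Nat.leb_gt; lia.
Qed.

Lemma qpoch_add (a q : C) (m n : nat) :
  qpoch a q (m + n) = qpoch a q m * qpoch (a * q ^ m) q n.
Proof.
induction n as [|n IH]; [rewrite Nat.add_0_r; simpl; ring|].
rewrite Nat.add_succ_r, !qpoch_S, IH, Cpow_add_r; ring.
Qed.

(** Covers both series, c = 0 for [e1] and c = 1 for [e2]. The exponent is arranged as (2i+j)^2 +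
    c(2i+j) + j(j-1)/2 + (i+1)k + k(k-1)/2. *)
Definition summand (q : C) (c i j k : nat) : C :=
  q ^ ((2 * i + j) * (2 * i + j) + c * (2 * i + j))
  * (theta_coef (- (1)) q j * inv_qfact q j) * inv_qfact q i
  * (theta_coef (- q ^ S i) q k * inv_qfact q k).

(** For fixed [i, j, k] the weight tends to [1]; its three factors complete the
    sums over [k], over [m = 2i + j] and the factor [(-q^{i+1};q)_N] to finite
    identities. *)
Definition weight (q : C) (N i j k : nat) : C :=
  qpoch q q N * inv_qfact_sub q N k * (qpoch q q N * inv_qfact_sub q N (2 * i + j))
  * (qpoch (- q) q N / qpoch (- q) q (N + i)).

(** The q-binomial sum over [k] gives (-q^{i+1};q)_N, which the weight reduces to (-q;q)_N /
    (-q;q)_i; sorting by 2i + j and [euler_convolution] then leave the finite Rogers-Ramanujan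
    sum. *)
Lemma weighted_sum (q : C) (c N : nat) :
  no_root_of_unity q -> (forall n, 1 + q ^ S n <> 0) -> (c <= 1)%nat ->
  csum (fun i => csum (fun j => csum (fun k =>
    summand q c i j k * weight q N i j k) (S N)) (S N)) (S N)
  = qpoch (- q) q N * qpoch q q N *
    bailey_beta q c (fun r => q ^ (r * r + c * r) *
      (q ^ (r * r + c * r) * jacobi_alpha c 1 q q r)) N.
Proof.
intros H H' Hc.
assert (Hm : forall n, qpoch (- q) q n <> 0).
{ intros n; apply qpoch_neq_0; intros k.
  replace (1 - - q * q ^ k) with (1 + q ^ S k) by (simpl; ring); apply H'. }
(* This is 1/(q^2;q^2)_i, since (q;q)_i (-q;q)_i = (q^2;q^2)_i. *)
set (a := fun i => inv_qfact q i / qpoch (- q) q i).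
set (b := fun j => theta_coef (- (1)) q j * inv_qfact q j).
set (g := fun m => q ^ (m * m + c * m) * inv_qfact_sub q N m).
transitivity (csum (fun i => csum (fun j =>
  qpoch (- q) q N * qpoch q q N * (g (2 * i + j)%nat * a i * b j)) (S N)) (S N)).
- apply csum_ext; intros i _; apply csum_ext; intros j _.
  rewrite (csum_ext _ (fun k =>
    (q ^ ((2 * i + j) * (2 * i + j) + c * (2 * i + j)) * b j * inv_qfact q i
     * (qpoch q q N * (qpoch q q N * inv_qfact_sub q N (2 * i + j))
        * (qpoch (- q) q N / qpoch (- q) q (N + i))))
    * (theta_coef (- q ^ S i) q k * inv_qfact q k * inv_qfact_sub q N k)))
    by (intros k _; unfold summand, weight, b; ring).
  rewrite csum_scal, qbinomial, (Nat.add_comm N i), qpoch_add by exact H.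
  replace (- q ^ S i) with (- q * q ^ i) by (simpl; ring).
  unfold g, a, inv_qfact; field.
  repeat apply conj; auto; try apply qfact_neq_0, H.
  intros E; apply (Hm (i + N)%nat); rewrite qpoch_add, E; ring.
- rewrite <- finite_rogers_ramanujan by auto.
  rewrite (csum_ext _ (fun i => qpoch (- q) q N * qpoch q q N *
     csum (fun j => g (2 * i + j)%nat * a i * b j) (S N)))
     by (intros i _; rewrite csum_scal; auto).
  rewrite csum_scal, csum_diagonal.
  + f_equal; apply csum_ext; intros m Hmn; unfold b; rewrite euler_convolution; auto.
    * unfold a; rewrite inv_qfact_0; simpl; field.
    * intros i; unfold a; rewrite <- (inv_qfact_S q i H), qpoch_S.
      replace (q ^ (2 * S i)) with (q ^ S i * q ^ S i)
        by (rewrite <- Cpow_add_r; f_equal; lia).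
      replace (1 - - q * q ^ i) with (1 + q ^ S i) by (simpl; ring).
      field; auto.
    * lia.
  + intros m Hmn; unfold g; rewrite inv_qfact_sub_gt by lia; ring.
Qed.

(** * The exponents of the two series *)

(** The relation on [t] expresses t = k(k-1)/2 without division. *)
Lemma theta_coef_pow (q : C) (a k t : nat) :
  (k * k = 2 * t + k)%nat -> theta_coef (- q ^ a) q k = q ^ (a * k + t).
Proof.
revert t; induction k as [|k IH]; intros t Ht.
- replace t with O by lia; rewrite Nat.mul_0_r; reflexivity.
- cbn [theta_coef]; rewrite (IH (t - k)%nat) by nia.
  replace (a * S k + t)%nat with (a + (k + (a * k + (t - k))))%nat by nia.
  rewrite !Cpow_add_r; ring.
Qed.

Lemma triangular (k : nat) : exists t, (k * k = 2 * t + k)%nat.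
Proof.
induction k as [|k [t Ht]]; [exists O; reflexivity|].
exists (t + k)%nat; lia.
Qed.

Lemma summand_theta (q : C) (c i j k s t : nat) :
  (j * j = 2 * s + j)%nat -> (k * k = 2 * t + k)%nat ->
  summand q c i j k
  = q ^ ((2 * i + j) * (2 * i + j) + c * (2 * i + j) + s + (S i * k + t))
    * (inv_qfact q i * inv_qfact q j * inv_qfact q k).
Proof.
intros Hs Ht; unfold summand.
change (- (1)) with (- q ^ 0).
rewrite (theta_coef_pow q 0 j s Hs), (theta_coef_pow q (S i) k t Ht).
change (0 * j + s)%nat with s.
rewrite !(Cpow_add_r q); ring.
Qed.

Lemma summand_eq (q : C) (c i j k e : nat) :
  no_root_of_unity q ->
  (forall s t, (j * j = 2 * s + j)%nat -> (k * k = 2 * t + k)%nat ->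
   e = (2 * i + j) * (2 * i + j) + c * (2 * i + j) + s + (S i * k + t))%nat ->
  summand q c i j k = pow_n q e / (qpoch q q i * qpoch q q j * qpoch q q k).
Proof.
intros H He; destruct (triangular j) as [s Hs], (triangular k) as [t Ht].
rewrite (summand_theta q c i j k s t Hs Ht), <- (He s t Hs Ht), (pow_n_Cpow q e).
unfold inv_qfact; field; auto using qfact_neq_0.
Qed.

Lemma summand_e1 (q : C) (i j k : nat) :
  no_root_of_unity q ->
  summand q 0 i j k
  = pow_n q (e1 i j k) / (qpoch q q i * qpoch q q j * qpoch q q k).
Proof.
intros H; apply summand_eq; [exact H|]; intros s t Hs Ht.
(* The [- j] in [e1] is never truncated, because 3j^2 >= j. *)
symmetry; apply Nat.div_unique_exact; nia.
Qed.

Lemma summand_e2 (q : C) (i j k : nat) :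
  no_root_of_unity q ->
  summand q 1 i j k
  = pow_n q (e2 i j k) / (qpoch q q i * qpoch q q j * qpoch q q k).
Proof.
intros H; apply summand_eq; [exact H|]; intros s t Hs Ht.
symmetry; apply Nat.div_unique_exact; nia.
Qed.

(** * Limits *)

(** Stated through real distances, so that the squeeze theorem and the arithmetic of real limits
    apply. *)
Definition Clim (u : nat -> C) (l : C) : Prop :=
  is_lim_seq (fun n => Cmod (u n - l)) 0%R.

Lemma Clim_filterlim (u : nat -> C) (l : C) :
  Clim u l <-> filterlim u eventually (locally l).
Proof.
unfold Clim; rewrite <- is_lim_seq_spec; split; intros H.
- apply (filterlim_locally_ball_norm (U := C_NormedModule)).
  intros eps; destruct (H eps) as [N HN]; exists N; intros n Hn.
  specialize (HN n Hn); rewrite Rminus_0_r, Rabs_pos_eq in HN by apply Cmod_ge_0.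
  exact HN.
- intros eps.
  destruct (proj1 (filterlim_locally_ball_norm (U := C_NormedModule) u l) H eps)
    as [N HN]; exists N; intros n Hn.
  rewrite Rminus_0_r, Rabs_pos_eq by apply Cmod_ge_0; exact (HN n Hn).
Qed.

Lemma Clim_ext (u v : nat -> C) (l : C) :
  (forall n, u n = v n) -> Clim u l -> Clim v l.
Proof.
intros E; apply is_lim_seq_ext; intros n; rewrite E; reflexivity.
Qed.

Lemma Clim_dominated (u : nat -> C) (l : C) (v : nat -> R) :
  (forall n, Cmod (u n - l) <= v n)%R -> is_lim_seq v 0%R -> Clim u l.
Proof.
intros H Hv; apply (is_lim_seq_le_le (fun _ => 0%R) _ v).
- intros n; split; [apply Cmod_ge_0 | apply H].
- apply is_lim_seq_const.
- exact Hv.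
Qed.

Lemma Clim_const (l : C) : Clim (fun _ => l) l.
Proof.
apply (Clim_dominated _ _ (fun _ => 0%R)); [|apply is_lim_seq_const].
intros n; replace (l - l) with (RtoC 0) by ring; rewrite Cmod_0; lra.
Qed.

Lemma Clim_plus (u v : nat -> C) (l m : C) :
  Clim u l -> Clim v m -> Clim (fun n => u n + v n) (l + m).
Proof.
intros Hu Hv.
apply (Clim_dominated _ _ (fun n => Cmod (u n - l) + Cmod (v n - m))%R).
- intros n; replace (u n + v n - (l + m)) with ((u n - l) + (v n - m)) by ring.
  apply Cmod_triangle.
- replace (Finite 0) with (Finite (0 + 0)) by (f_equal; ring).
  apply is_lim_seq_plus'; assumption.
Qed.

Lemma Clim_mult (u v : nat -> C) (l m : C) :
  Clim u l -> Clim v m -> Clim (fun n => u n * v n) (l * m).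
Proof.
intros Hu Hv.
apply (Clim_dominated _ _ (fun n => Cmod (u n - l) * Cmod (v n - m)
   + (Cmod l * Cmod (v n - m) + Cmod m * Cmod (u n - l)))%R).
- intros n; rewrite <- !Cmod_mult.
  replace (u n * v n - l * m) with
    ((u n - l) * (v n - m) + (l * (v n - m) + m * (u n - l))) by ring.
  eapply Rle_trans; [apply Cmod_triangle|].
  apply Rplus_le_compat_l, Cmod_triangle.
- replace (Finite 0) with (Finite (0 * 0 + (Cmod l * 0 + Cmod m * 0)))
    by (f_equal; ring).
  apply is_lim_seq_plus'; [apply is_lim_seq_mult'; assumption|].
  apply is_lim_seq_plus'; apply is_lim_seq_mult'; auto using is_lim_seq_const.
Qed.

Lemma Clim_minus (u v : nat -> C) (l m : C) :
  Clim u l -> Clim v m -> Clim (fun n => u n - v n) (l - m).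
Proof.
intros Hu Hv.
apply Clim_ext with (fun n => u n + - (1) * v n); [intros n; ring|].
replace (l - m) with (l + - (1) * m) by ring.
apply Clim_plus; [exact Hu|]; apply Clim_mult; auto using Clim_const.
Qed.

Lemma Clim_unique (u : nat -> C) (l m : C) : Clim u l -> Clim u m -> l = m.
Proof.
rewrite !Clim_filterlim.
apply (filterlim_locally_unique (V := C_NormedModule) u).
Qed.

Lemma Clim_subseq (u : nat -> C) (l : C) (phi : nat -> nat) :
  (forall n, (n <= phi n)%nat) -> Clim u l -> Clim (fun n => u (phi n)) l.
Proof.
intros Hphi; apply (is_lim_seq_subseq (fun n => Cmod (u n - l)) _ phi).
intros P [N HN]; exists N; intros n Hn; apply HN; specialize (Hphi n); lia.
Qed.

Lemma Clim_incr_n (u : nat -> C) (l : C) (k : nat) :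
  Clim (fun n => u (n + k)%nat) l -> Clim u l.
Proof. apply (is_lim_seq_incr_n (fun n => Cmod (u n - l)) k). Qed.

(** [lim] is only specified on Cauchy filters; convergence provides one, and uniqueness of limits
    identifies the value. *)
Lemma qpoch_inf_eq (a q l : C) : Clim (qpoch a q) l -> qpoch_inf a q = l.
Proof.
rewrite Clim_filterlim; intros H.
assert (Hc : cauchy (T := C_CompleteNormedModule)
  (filtermap (fun n => qpoch a q n) eventually)).
{ intros eps; exists l.
  apply H; exists eps; auto. }
assert (Hl := complete_cauchy (T := C_CompleteNormedModule) _ _ Hc).
apply (filterlim_locally_unique (F := eventually) (V := C_NormedModule) (qpoch a q));
  [|exact H].
apply (filterlim_locally (U := C_UniformSpace)); exact Hl.
Qed.

Lemma sum_n_csum (f : nat -> C) (N : nat) : sum_n f N = csum f (S N).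
Proof.
induction N as [|N IH]; [rewrite sum_O; simpl; ring|].
rewrite sum_Sn, IH; reflexivity.
Qed.

Lemma Clim_triple_series (f : nat -> nat -> nat -> C) (l : C) :
  Clim (fun N => csum (fun i => csum (fun j => csum (fun k => f i j k)
    (S N)) (S N)) (S N)) l -> triple_series_to f l.
Proof.
intros H; apply Clim_filterlim; revert H; apply Clim_ext; intros N.
unfold cube_psum; rewrite sum_n_csum; apply csum_ext; intros i _.
rewrite sum_n_csum; apply csum_ext; intros j _.
symmetry; apply sum_n_csum.
Qed.

(** * Dominated convergence under geometric bounds *)

Local Open Scope R_scope.

Lemma csum_geom_bound (f : nat -> C) (K r : R) (n : nat) :
  0 <= K -> 0 <= r < 1 -> (forall k, Cmod (f k) <= K * r ^ k) ->
  Cmod (csum f n) <= K / (1 - r).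
Proof.
intros HK Hr Hf.
apply Rle_trans with (K * (1 - r ^ n) / (1 - r)).
- induction n as [|n IH].
  + simpl; rewrite Cmod_0; right; field; lra.
  + simpl csum; eapply Rle_trans; [apply Cmod_triangle|].
    replace (K * (1 - r ^ S n) / (1 - r))
      with (K * (1 - r ^ n) / (1 - r) + K * r ^ n) by (simpl; field; lra).
    apply Rplus_le_compat; auto.
- apply Rmult_le_compat_r; [left; apply Rinv_0_lt_compat; lra|].
  assert (0 <= r ^ n) by (apply pow_le; lra); nra.
Qed.

(** Tannery's theorem with a growing range: past a fixed M the sum is at most K r^M / (1-r),
    uniformly in N, and the first M terms are a finite sum of null sequences. *)
Lemma tannery (D : nat -> nat -> C) (K r : R) :
  0 <= K -> 0 <= r < 1 -> (forall N n, Cmod (D N n) <= K * r ^ n) ->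
  (forall n, Clim (fun N => D N n) 0) ->
  Clim (fun N => csum (D N) (S N)) 0.
Proof.
intros HK Hr HD Hlim.
assert (Hhead : forall M, Clim (fun N => csum (D N) M) 0).
{ induction M as [|M IH]; simpl; [apply Clim_const|].
  replace (RtoC 0) with (0 + 0)%C by ring; apply Clim_plus; auto. }
apply is_lim_seq_spec; intros eps.
assert (Hgeom : is_lim_seq (fun M => K / (1 - r) * r ^ M) 0).
{ replace (Finite 0) with (Finite (K / (1 - r) * 0)) by (f_equal; ring).
  apply is_lim_seq_mult'; [apply is_lim_seq_const|].
  apply is_lim_seq_geom; rewrite Rabs_pos_eq; lra. }
assert (He : 0 < eps / 2) by (assert (H := cond_pos eps); lra).
destruct (proj2 (is_lim_seq_spec _ _) Hgeom (mkposreal _ He)) as [M HM].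
specialize (HM M (le_n M)); simpl in HM.
destruct (proj2 (is_lim_seq_spec _ _) (Hhead M) (mkposreal _ He)) as [N0 HN0].
exists (N0 + M)%nat; intros N HN; specialize (HN0 N ltac:(lia)); simpl in HN0.
assert (E : forall z, (z - 0)%C = z) by (intros z; ring).
assert (Ea : forall z, Rabs (Cmod z) = Cmod z)
  by (intros z; apply Rabs_pos_eq, Cmod_ge_0).
rewrite E, Rminus_0_r, Ea in HN0 |- *.
rewrite Rminus_0_r in HM; apply Rle_lt_trans with (1 := Rle_abs _) in HM.
replace (S N) with (M + (S N - M))%nat by lia.
rewrite csum_add; eapply Rle_lt_trans; [apply Cmod_triangle|].
assert (Cmod (csum (fun k => D N (M + k)%nat) (S N - M)) <= K * r ^ M / (1 - r)).
{ apply csum_geom_bound; auto.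
  - apply Rmult_le_pos; [lra|]; apply pow_le; lra.
  - intros k; rewrite Rmult_assoc, <- pow_add; apply HD. }
replace (K * r ^ M / (1 - r)) with (K / (1 - r) * r ^ M) in * by (field; lra).
lra.
Qed.

(** Summing out an index keeps a geometric bound in the remaining ones, so [tannery] applies at each
    of the three levels. *)
Lemma tannery3 (D : nat -> nat -> nat -> nat -> C) (K r : R) :
  0 <= K -> 0 <= r < 1 ->
  (forall N i j k, Cmod (D N i j k) <= K * r ^ i * r ^ j * r ^ k) ->
  (forall i j k, Clim (fun N => D N i j k) 0) ->
  Clim (fun N => csum (fun i => csum (fun j => csum (fun k => D N i j k)
    (S N)) (S N)) (S N)) 0.
Proof.
intros HK Hr HD Hlim.
assert (Hp : forall n, 0 <= r ^ n) by (intros n; apply pow_le; lra).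
assert (Hi : 0 <= / (1 - r)) by (left; apply Rinv_0_lt_compat; lra).
assert (B1 : forall N i j, Cmod (csum (fun k => D N i j k) (S N))
  <= K / (1 - r) * r ^ i * r ^ j).
{ intros N i j; replace (K / (1 - r) * r ^ i * r ^ j)
    with (K * r ^ i * r ^ j / (1 - r)) by (field; lra).
  apply csum_geom_bound; auto using Rmult_le_pos. }
assert (B2 : forall N i, Cmod (csum (fun j => csum (fun k => D N i j k) (S N)) (S N))
  <= K / (1 - r) / (1 - r) * r ^ i).
{ intros N i; replace (K / (1 - r) / (1 - r) * r ^ i)
    with (K / (1 - r) * r ^ i / (1 - r)) by (field; lra).
  apply csum_geom_bound; auto; unfold Rdiv; auto using Rmult_le_pos. }
apply (tannery _ (K / (1 - r) / (1 - r)) r); auto.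
{ unfold Rdiv; auto using Rmult_le_pos. }
intros i; apply (tannery (fun N j => csum (fun k => D N i j k) (S N))
  (K / (1 - r) * r ^ i) r); auto.
{ unfold Rdiv; auto using Rmult_le_pos. }
intros j; apply (tannery (fun N k => D N i j k) (K * r ^ i * r ^ j) r);
  auto using Rmult_le_pos.
Qed.

(** * Convergence of infinite products *)

(** By 1 + x <= e^x the partial products are bounded by exp(A/(1-r)), so their increments [P n]
    times [c n] are geometrically dominated and telescope to a limit. *)
Lemma infinite_product (P c : nat -> C) (A r : R) :
  0 <= A -> 0 <= r < 1 -> P O = 1%C ->
  (forall n, P (S n) = (P n * (1 + c n))%C) ->
  (forall n, Cmod (c n) <= A * r ^ n) ->
  exists (l : C) (K : R), Clim P l /\ forall n, Cmod (P n) <= K.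
Proof.
intros HA Hr H0 HS Hc.
set (K := exp (A / (1 - r))).
assert (HP : forall n, Cmod (P n) <= K).
{ intros n; apply Rle_trans with (exp (A * (1 - r ^ n) / (1 - r))).
  - induction n as [|n IH].
    + rewrite H0, Cmod_1; simpl.
      replace (A * (1 - 1) / (1 - r)) with 0 by (field; lra); rewrite exp_0; lra.
    + rewrite HS, Cmod_mult.
      replace (A * (1 - r ^ S n) / (1 - r))
        with (A * (1 - r ^ n) / (1 - r) + A * r ^ n) by (simpl; field; lra).
      rewrite exp_plus; apply Rmult_le_compat; auto using Cmod_ge_0.
      apply Rle_trans with (1 + A * r ^ n); [|apply exp_ineq1_le].
      eapply Rle_trans; [apply Cmod_triangle|]; rewrite Cmod_1.
      apply Rplus_le_compat_l, Hc.
  - assert (0 <= r ^ n) by (apply pow_le; lra).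
    assert (HE : A * (1 - r ^ n) / (1 - r) <= A / (1 - r)).
    { apply Rmult_le_compat_r; [left; apply Rinv_0_lt_compat; lra|]; nra. }
    destruct HE as [HE|HE]; [left; apply exp_increasing, HE | right; now rewrite HE]. }
set (d := fun n => (P (S n) - P n)%C).
destruct (ex_series_le (V := C_CompleteNormedModule) d (fun n => K * A * r ^ n))
  as [l Hl].
- intros n; change (Cmod (d n) <= K * A * r ^ n); unfold d; rewrite HS.
  replace (P n * (1 + c n) - P n)%C with (P n * c n)%C by ring.
  rewrite Cmod_mult, Rmult_assoc; apply Rmult_le_compat; auto using Cmod_ge_0.
- apply (ex_series_scal (V := R_NormedModule) (K * A)).
  apply ex_series_geom; rewrite Rabs_pos_eq; lra.
- exists (l + 1)%C, K; split; [|exact HP].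
  apply Clim_incr_n with 1%nat.
  apply Clim_ext with (fun n => (sum_n d n + 1)%C).
  + intros n; rewrite sum_n_csum, Nat.add_1_r.
    assert (E : forall m, csum d m = (P m - 1)%C).
    { induction m as [|m IH]; simpl; [rewrite H0; ring|].
      rewrite IH; unfold d; ring. }
    rewrite E; ring.
  + apply Clim_plus; [|apply Clim_const]; apply Clim_filterlim, Hl.
Qed.

Lemma Cmod_mult_pow_lt (a q : C) (n : nat) :
  Cmod a < 1 -> Cmod q < 1 -> Cmod (a * q ^ n) < 1.
Proof.
intros Ha Hq; rewrite Cmod_mult, Cmod_pow.
assert (Hn : 0 <= Cmod q ^ n <= 1).
{ split; [apply pow_le, Cmod_ge_0|].
  rewrite <- (pow1 n); apply pow_incr; split; [apply Cmod_ge_0 | lra]. }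
assert (H := Cmod_ge_0 a); nra.
Qed.

Lemma Cmod_lt_1_neq (z : C) : Cmod z < 1 -> (1 - z)%C <> 0%C.
Proof.
intros Hz E; assert (z = 1%C) as Ez.
{ transitivity (1 - (1 - z))%C; [ring|]; rewrite E; ring. }
rewrite Ez, Cmod_1 in Hz; lra.
Qed.

Lemma qpoch_neq_0_lt (a q : C) (n : nat) :
  Cmod a < 1 -> Cmod q < 1 -> qpoch a q n <> 0%C.
Proof.
intros Ha Hq; apply qpoch_neq_0; intros k.
apply Cmod_lt_1_neq, Cmod_mult_pow_lt; auto.
Qed.

Lemma no_root_of_unity_lt (q : C) : Cmod q < 1 -> no_root_of_unity q.
Proof.
intros Hq n; apply Cmod_lt_1_neq; change (q ^ S n)%C with (q * q ^ n)%C.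
apply Cmod_mult_pow_lt; auto.
Qed.

(** The products and their reciprocals both fall under [infinite_product]; their limits multiply to
    1, so neither is 0. *)
Lemma qpoch_limit (a q : C) :
  Cmod a < 1 -> Cmod q < 1 ->
  exists (l : C) (K : R), l <> 0%C /\ Clim (qpoch a q) l /\
    Clim (fun n => / qpoch a q n)%C (/ l)%C /\
    forall n, Cmod (qpoch a q n) <= K /\ Cmod (/ qpoch a q n) <= K.
Proof.
intros Ha Hq.
assert (Hr : 0 <= Cmod q < 1) by (split; [apply Cmod_ge_0 | exact Hq]).
assert (Hnz := fun k => Cmod_lt_1_neq _ (Cmod_mult_pow_lt a q k Ha Hq)).
assert (Hp := fun n => qpoch_neq_0_lt a q n Ha Hq).
assert (Ha0 := Cmod_ge_0 a).
destruct (infinite_product (qpoch a q) (fun n => - (a * q ^ n))%C (Cmod a) (Cmod q))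
  as (l & K & Hl & HK); auto.
{ intros n; rewrite Cmod_opp, Cmod_mult, Cmod_pow; lra. }
(* With z = a q^n, the reciprocal factor is 1/(1-z) = 1 + z/(1-z), and |1-z| >= 1 - |a| gives the
   constant. *)
destruct (infinite_product (fun n => / qpoch a q n)%C
  (fun n => a * q ^ n / (1 - a * q ^ n))%C (Cmod a / (1 - Cmod a)) (Cmod q))
  as (m & K' & Hm & HK'); auto.
{ apply Rmult_le_pos; [auto | left; apply Rinv_0_lt_compat; lra]. }
{ simpl; field. }
{ intros n; cbv beta; rewrite qpoch_S; field; auto. }
{ intros n; rewrite Cmod_div, Cmod_mult, Cmod_pow by auto.
  unfold Rdiv; rewrite !Rmult_assoc, (Rmult_comm (/ (1 - Cmod a))).
  apply Rmult_le_compat_l; [auto|].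
  apply Rmult_le_compat_l; [apply pow_le, Hr|].
  apply Rinv_le_contravar; [lra|].
  assert (Hn : Cmod q ^ n <= 1).
  { rewrite <- (pow1 n); apply pow_incr; lra. }
  assert (Ht := Cmod_triangle (1 - a * q ^ n) (a * q ^ n)).
  replace (1 - a * q ^ n + a * q ^ n)%C with (RtoC 1) in Ht by ring.
  rewrite Cmod_1, Cmod_mult, Cmod_pow in Ht; nra. }
assert (E : (l * m)%C = 1%C).
{ apply (Clim_unique (fun n => qpoch a q n * / qpoch a q n)%C).
  - apply Clim_mult; assumption.
  - apply Clim_ext with (fun _ => 1%C); [|apply Clim_const].
    intros n; field; auto. }
assert (Hl0 : l <> 0%C).
{ intros Hl0; rewrite Hl0, Cmult_0_l in E; apply C1_nz; auto. }
exists l, (Rmax K K'); split; [exact Hl0|]; split; [exact Hl|]; split.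
- replace (/ l)%C with m; [exact Hm|].
  apply (Cmult_cancel_l l); [exact Hl0|]; rewrite E; field; exact Hl0.
- intros n; split.
  + eapply Rle_trans; [apply HK | apply Rmax_l].
  + eapply Rle_trans; [apply HK' | apply Rmax_r].
Qed.

(** * Bounds and limits for the summand, the weight and the kernels *)

Local Open Scope C_scope.

Lemma Cmod_inv_qfact_sub (q : C) (K : R) (N r : nat) :
  (forall n, Cmod (inv_qfact q n) <= K)%R -> (Cmod (inv_qfact_sub q N r) <= K)%R.
Proof.
intros HK; unfold inv_qfact_sub; destruct (Nat.leb r N); [apply HK|].
rewrite Cmod_0; apply Rle_trans with (2 := HK O), Cmod_ge_0.
Qed.

Lemma Clim_inv_qfact_sub (q l : C) (r : nat) :
  Clim (inv_qfact q) l -> Clim (fun N => inv_qfact_sub q N r) l.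
Proof.
intros H; apply Clim_incr_n with r; revert H; apply Clim_ext; intros n.
rewrite inv_qfact_sub_le by lia; f_equal; lia.
Qed.

Lemma Cmod_pow_le (q : C) (m n : nat) :
  (Cmod q < 1)%R -> (m <= n)%nat -> (Cmod (q ^ n) <= Cmod q ^ m)%R.
Proof.
intros Hq Hmn; rewrite Cmod_pow; replace n with (m + (n - m))%nat by lia.
rewrite pow_add.
assert (H := Cmod_ge_0 q).
assert (0 <= Cmod q ^ m)%R by (apply pow_le; lra).
assert (Cmod q ^ (n - m) <= 1)%R.
{ rewrite <- (pow1 (n - m)); apply pow_incr; lra. }
nra.
Qed.

Lemma Cmod_mult_le (x y : C) (A B : R) :
  (Cmod x <= A)%R -> (Cmod y <= B)%R -> (Cmod (x * y) <= A * B)%R.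
Proof.
intros Hx Hy; rewrite Cmod_mult; apply Rmult_le_compat; auto using Cmod_ge_0.
Qed.

Lemma Cmod_plus_le (x y : C) (A B : R) :
  (Cmod x <= A)%R -> (Cmod y <= B)%R -> (Cmod (x + y) <= A + B)%R.
Proof.
intros Hx Hy; apply Rle_trans with (1 := Cmod_triangle x y).
apply Rplus_le_compat; assumption.
Qed.

Lemma Cmod_minus_le (x y : C) (A B : R) :
  (Cmod x <= A)%R -> (Cmod y <= B)%R -> (Cmod (x - y) <= A + B)%R.
Proof.
intros Hx Hy; apply Cmod_plus_le; [|rewrite Cmod_opp]; assumption.
Qed.

Lemma Cmod_theta_coef (x q : C) (r : nat) :
  (Cmod x <= 1)%R -> (Cmod q < 1)%R -> (Cmod (theta_coef x q r) <= 1)%R.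
Proof.
intros Hx Hq; induction r as [|r IH]; [simpl; rewrite Cmod_1; lra|].
simpl theta_coef; replace 1%R with (1 * 1 * 1)%R by ring.
apply Cmod_mult_le; [apply Cmod_mult_le|exact IH].
- rewrite Cmod_opp; exact Hx.
- apply (Cmod_pow_le q 0 r); [exact Hq | lia].
Qed.

Lemma Cmod_jacobi_alpha (c r : nat) (x y q : C) :
  (Cmod x <= 1)%R -> (Cmod y <= 1)%R -> (Cmod q < 1)%R ->
  (Cmod (jacobi_alpha c x y q r) <= 2)%R.
Proof.
intros Hx Hy Hq.
assert (H : (Cmod (theta_coef x q r + theta_coef y q (r + c)) <= 2)%R).
{ replace 2%R with (1 + 1)%R by ring.
  apply Cmod_plus_le; apply Cmod_theta_coef; auto. }
destruct c, r; auto; simpl; rewrite Cmod_1; lra.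
Qed.

(** The exponent in [summand_theta] is at least i + j + k, because (2i+j)^2 >= 2i + j and (i+1)k >=
    k. *)
Lemma Cmod_summand (q : C) (K : R) (c i j k : nat) :
  (Cmod q < 1)%R -> (forall n, Cmod (inv_qfact q n) <= K)%R ->
  (Cmod (summand q c i j k)
   <= K * K * K * Cmod q ^ i * Cmod q ^ j * Cmod q ^ k)%R.
Proof.
intros Hq HK; destruct (triangular j) as [s Hs], (triangular k) as [t Ht].
rewrite (summand_theta q c i j k s t Hs Ht).
replace (K * K * K * Cmod q ^ i * Cmod q ^ j * Cmod q ^ k)%R
  with (Cmod q ^ (i + j + k) * (K * K * K))%R by (rewrite !pow_add; ring).
repeat apply Cmod_mult_le; auto.
apply Cmod_pow_le; [exact Hq | nia].
Qed.

Lemma Cmod_weight (q : C) (K : R) (N i j k : nat) :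
  (forall n, Cmod (qpoch q q n) <= K)%R ->
  (forall n, Cmod (inv_qfact q n) <= K)%R ->
  (forall n, Cmod (qpoch (- q) q n) <= K)%R ->
  (forall n, Cmod (/ qpoch (- q) q n) <= K)%R ->
  (Cmod (weight q N i j k) <= K * K * (K * K) * (K * K))%R.
Proof.
intros H1 H2 H3 H4.
repeat apply Cmod_mult_le; auto using Cmod_inv_qfact_sub.
Qed.

Lemma Clim_weight (q : C) (i j k : nat) :
  (Cmod q < 1)%R -> Clim (fun N => weight q N i j k) 1.
Proof.
intros Hq.
destruct (qpoch_limit q q Hq Hq) as (l & K & Hl & L1 & L2 & _).
destruct (qpoch_limit (- q) q) as (m & K' & Hm & M1 & M2 & _); auto.
{ rewrite Cmod_opp; exact Hq. }
replace (RtoC 1) with (l * / l * (l * / l) * (m * / m)) by (field; auto).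
repeat apply Clim_mult; auto using Clim_inv_qfact_sub.
apply (Clim_subseq (fun n => / qpoch (- q) q n) (/ m) (fun N => (N + i)%nat));
  [intros n; lia | exact M2].
Qed.

Lemma Clim_0_minus (u v : nat -> C) (l : C) :
  Clim (fun n => u n - v n) 0 -> Clim v l -> Clim u l.
Proof.
intros Huv Hv; apply Clim_ext with (fun n => (u n - v n) + v n); [intros n; ring|].
replace l with (0 + l) by ring; apply Clim_plus; assumption.
Qed.

(** Tannery's theorem for [summand] times 1 - [weight]: the weight is uniformly bounded and tends to
    1 at fixed indices. *)
Lemma Clim_summand_weighted (q : C) (c : nat) :
  (Cmod q < 1)%R ->
  Clim (fun N =>
    csum (fun i => csum (fun j => csum (fun k => summand q c i j k)
      (S N)) (S N)) (S N)
    - csum (fun i => csum (fun j => csum (fun k =>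
        summand q c i j k * weight q N i j k) (S N)) (S N)) (S N)) 0.
Proof.
intros Hq.
destruct (qpoch_limit q q Hq Hq) as (l & K1 & _ & _ & _ & B1).
destruct (qpoch_limit (- q) q) as (m & K2 & _ & _ & _ & B2); auto.
{ rewrite Cmod_opp; exact Hq. }
set (K := Rmax K1 K2).
assert (HK1 : (K1 <= K)%R) by apply Rmax_l.
assert (HK2 : (K2 <= K)%R) by apply Rmax_r.
assert (HK : (0 <= K)%R).
{ apply Rle_trans with (2 := HK1), Rle_trans with (2 := proj1 (B1 O)), Cmod_ge_0. }
assert (Hi : forall n, (Cmod (inv_qfact q n) <= K)%R)
  by (intros n; apply Rle_trans with (2 := HK1), B1).
apply Clim_ext with (fun N => csum (fun i => csum (fun j => csum (fun k =>
  summand q c i j k * (1 - weight q N i j k)) (S N)) (S N)) (S N)).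
{ intros N; rewrite <- csum_minus; apply csum_ext; intros i _.
  rewrite <- csum_minus; apply csum_ext; intros j _.
  rewrite <- csum_minus; apply csum_ext; intros k _; ring. }
apply (tannery3 (fun N i j k => summand q c i j k * (1 - weight q N i j k))
  (K * K * K * (1 + K * K * (K * K) * (K * K))) (Cmod q)).
- assert (0 <= K * K)%R by auto using Rmult_le_pos.
  assert (0 <= K * K * (K * K) * (K * K))%R by auto using Rmult_le_pos.
  repeat apply Rmult_le_pos; auto; lra.
- split; [apply Cmod_ge_0 | exact Hq].
- intros N i j k.
  eapply Rle_trans; [apply Cmod_mult_le; [apply (Cmod_summand q K); auto|]|].
  + apply Cmod_minus_le; [rewrite Cmod_1; apply Rle_refl|].
    apply Cmod_weight with (K := K); auto; intros n;
      (apply Rle_trans with (2 := HK1), B1 || apply Rle_trans with (2 := HK2), B2).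
  + right; ring.
- intros i j k; replace (RtoC 0) with (summand q c i j k * (1 - 1)) by ring.
  apply Clim_mult, Clim_minus; auto using Clim_const, Clim_weight.
Qed.

(** Both normalised kernels tend to 1, so changing the base of the kernel does
    not affect the limit. *)
Lemma Clim_bailey_rebase (q p : C) (c : nat) (alpha : nat -> C) (A r : R) :
  (Cmod q < 1)%R -> (Cmod p < 1)%R -> (0 <= A)%R -> (0 <= r < 1)%R ->
  (forall n, Cmod (alpha n) <= A * r ^ n)%R ->
  Clim (fun N => qpoch q q N * qpoch q q N * bailey_beta q c alpha N
    - qpoch p p N * qpoch p p N * bailey_beta p c alpha N) 0.
Proof.
intros Hq Hp HA Hr Halpha.
set (kernel := fun q N n => qpoch q q N * qpoch q q N
  * (inv_qfact_sub q N n * inv_qfact q (N + n + c))).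
assert (Hkernel : forall q, (Cmod q < 1)%R -> exists K : R,
  (0 <= K)%R /\ (forall N n, Cmod (kernel q N n) <= K)%R /\
  forall n, Clim (fun N => kernel q N n) 1).
{ clear; intros q Hq.
  destruct (qpoch_limit q q Hq Hq) as (l & K & Hl & L1 & L2 & B).
  assert (HK : (0 <= K)%R).
  { apply Rle_trans with (2 := proj1 (B O)), Cmod_ge_0. }
  assert (B1 := fun n => proj1 (B n)).
  assert (B2 : forall n, (Cmod (inv_qfact q n) <= K)%R) by (intros n; apply B).
  exists (K * K * (K * K))%R; split; [auto using Rmult_le_pos|]; split.
  - intros N n; repeat apply Cmod_mult_le; auto using Cmod_inv_qfact_sub.
  - intros n; replace (RtoC 1) with (l * l * (/ l * / l)) by (field; auto).
    repeat apply Clim_mult; auto using Clim_inv_qfact_sub.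
    apply (Clim_subseq (inv_qfact q) (/ l) (fun N => (N + n + c)%nat));
      [intros m; lia | exact L2]. }
destruct (Hkernel q Hq) as (K & HK & BK & LK).
destruct (Hkernel p Hp) as (K' & HK' & BK' & LK').
apply Clim_ext with (fun N => csum (fun n => alpha n * (kernel q N n - kernel p N n)) (S N)).
{ intros N; unfold bailey_beta; rewrite <- !csum_scal, <- csum_minus.
  apply csum_ext; intros n _; unfold kernel; ring. }
apply (tannery (fun N n => alpha n * (kernel q N n - kernel p N n))
  (A * (K + K')) r); auto.
- apply Rmult_le_pos; lra.
- intros N n; replace (A * (K + K') * r ^ n)%R with (A * r ^ n * (K + K'))%R by ring.
  apply Cmod_mult_le; [auto|]; apply Cmod_minus_le; auto.
- intros n; replace (RtoC 0) with (alpha n * (1 - 1)) by ring.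
  apply Clim_mult, Clim_minus; auto using Clim_const.
Qed.

(** * Evaluation of the triple sums *)

Lemma Clim_triple_sum (q x y qq qm px py pp : C) (c : nat) :
  (Cmod q < 1)%R -> (Cmod x < 1)%R -> (Cmod y < 1)%R ->
  (c <= 1)%nat -> x * y = q ^ 5 ->
  (forall r, q ^ (r * r + c * r) * (q ^ (r * r + c * r) * jacobi_alpha c 1 q q r)
    = jacobi_alpha c x y (q ^ 5) r) ->
  Clim (qpoch q q) qq -> Clim (qpoch (- q) q) qm ->
  Clim (qpoch x (q ^ 5)) px -> Clim (qpoch y (q ^ 5)) py ->
  Clim (qpoch (q ^ 5) (q ^ 5)) pp -> qq <> 0 -> pp <> 0 ->
  Clim (fun N => csum (fun i => csum (fun j => csum (fun k => summand q c i j k)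
    (S N)) (S N)) (S N)) (qm * / qq * (px * py * pp)).
Proof.
intros Hq Hx Hy Hc Hxy Halpha Lq Lm Lx Ly Lp Hqq Hpp.
assert (Hn := no_root_of_unity_lt q Hq).
assert (Hp : (Cmod (q ^ 5) < 1)%R).
{ change (q ^ 5) with (q * q ^ 4); apply Cmod_mult_pow_lt; auto. }
assert (Hnp := no_root_of_unity_lt (q ^ 5) Hp).
assert (Hm : (Cmod (- q) < 1)%R) by (rewrite Cmod_opp; exact Hq).
assert (Linv : forall (a b l : C), (Cmod a < 1)%R -> (Cmod b < 1)%R ->
  Clim (qpoch a b) l -> Clim (fun n => / qpoch a b n) (/ l)).
{ intros a b l Ha Hb Hl.
  destruct (qpoch_limit a b Ha Hb) as (l' & K & _ & Hl' & Hi & _).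
  rewrite (Clim_unique _ _ _ Hl Hl'); exact Hi. }
eapply Clim_0_minus; [apply Clim_summand_weighted; exact Hq|].
set (alpha := fun r => q ^ (r * r + c * r) *
  (q ^ (r * r + c * r) * jacobi_alpha c 1 q q r)).
(* Two factors (q;q)_N are set aside to normalise the kernel, at the price of 1/(q;q)_N in front. *)
apply Clim_ext with (fun N => qpoch (- q) q N * / qpoch q q N
  * (qpoch q q N * qpoch q q N * bailey_beta q c alpha N)).
{ intros N; rewrite weighted_sum; auto.
  - fold alpha; field; apply qfact_neq_0, Hn.
  - intros n; replace (1 + q ^ S n) with (1 - - q * q ^ n) by (simpl; ring).
    apply Cmod_lt_1_neq, Cmod_mult_pow_lt; auto. }
apply Clim_mult; [apply Clim_mult; auto|].
eapply Clim_0_minus.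
(* The constant 2 bounds [jacobi_alpha], and 2(n^2 + cn) >= n gives the ratio |q|. *)
{ apply (Clim_bailey_rebase q (q ^ 5) c alpha 2 (Cmod q)); auto; try lra.
  - split; [apply Cmod_ge_0 | exact Hq].
  - intros n; unfold alpha; rewrite Cmult_assoc, <- Cpow_add_r, Rmult_comm.
    apply Cmod_mult_le; [apply Cmod_pow_le; [exact Hq | nia]|].
    apply Cmod_jacobi_alpha; auto; rewrite ?Cmod_1; lra. }
apply Clim_ext with (fun N => qpoch (q ^ 5) (q ^ 5) N * qpoch (q ^ 5) (q ^ 5) N
  * (qpoch x (q ^ 5) N * qpoch y (q ^ 5) (N + c) * inv_qfact (q ^ 5) (2 * N + c))).
{ intros N; f_equal; rewrite (bailey_beta_ext _ _ alpha _ N Halpha).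
  destruct (finite_jacobi x y (q ^ 5) N Hnp Hxy) as [E0 E1].
  assert (c = 0 \/ c = 1)%nat as [-> | ->] by lia.
  - rewrite E0, !Nat.add_0_r; reflexivity.
  - rewrite E1, !Nat.add_1_r; reflexivity. }
(* With p = q^5, the denominator (p;p)_{2N+c} of the triple product cancels one of the two factors
   (p;p)_N in the limit. *)
replace (px * py * pp) with (pp * pp * (px * py * / pp)) by (field; exact Hpp).
repeat apply Clim_mult; auto.
- apply (Clim_subseq _ _ (fun N => (N + c)%nat)); [intros n; lia | exact Ly].
- apply (Clim_subseq (inv_qfact (q ^ 5)) (/ pp) (fun N => (2 * N + c)%nat));
    [intros n; lia | apply Linv; auto].
Qed.

(** Sorts the factors 1 - q^k by the residue of k modulo 5. *)
Lemma qfact_mod5 (q : C) (n : nat) :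
  qpoch q q (5 * n) = qpoch q (q ^ 5) n * qpoch (q ^ 2) (q ^ 5) n
    * qpoch (q ^ 3) (q ^ 5) n * qpoch (q ^ 4) (q ^ 5) n * qpoch (q ^ 5) (q ^ 5) n.
Proof.
induction n as [|n IH]; [simpl; ring|].
replace (5 * S n)%nat with (S (S (S (S (S (5 * n)))))) by lia.
rewrite !qpoch_S, IH, <- Cpow_mult_r; simpl; ring.
Qed.

Theorem theorem4p14 (q : C) (hq : Cmod q < 1) :
  triple_series_to
    (fun i j k => Cdiv (pow_n q (e1 i j k))
                       (Cmult (Cmult (qpoch q q i) (qpoch q q j)) (qpoch q q k)))
    (Cdiv (qpoch_inf (Copp q) q)
          (Cmult (qpoch_inf q (pow_n q 5)) (qpoch_inf (pow_n q 4) (pow_n q 5))))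
  /\
  triple_series_to
    (fun i j k => Cdiv (pow_n q (e2 i j k))
                       (Cmult (Cmult (qpoch q q i) (qpoch q q j)) (qpoch q q k)))
    (Cdiv (qpoch_inf (Copp q) q)
          (Cmult (qpoch_inf (pow_n q 2) (pow_n q 5)) (qpoch_inf (pow_n q 3) (pow_n q 5)))).
Proof.
rewrite (pow_n_Cpow q 2), (pow_n_Cpow q 3), (pow_n_Cpow q 4), (pow_n_Cpow q 5).
assert (Hn := no_root_of_unity_lt q hq).
assert (Ha : forall a, (Cmod (q ^ S a) < 1)%R).
{ intros a; change (q ^ S a) with (q * q ^ a); apply Cmod_mult_pow_lt; auto. }
destruct (qpoch_limit q q hq hq) as (qq & _ & Nq & Lq & _).
destruct (qpoch_limit (- q) q) as (qm & _ & _ & Lm & _); auto.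
{ rewrite Cmod_opp; exact hq. }
destruct (qpoch_limit q (q ^ 5) hq (Ha 4%nat)) as (l1 & _ & N1 & L1 & _).
destruct (qpoch_limit (q ^ 2) (q ^ 5) (Ha 1%nat) (Ha 4%nat)) as (l2 & _ & N2 & L2 & _).
destruct (qpoch_limit (q ^ 3) (q ^ 5) (Ha 2%nat) (Ha 4%nat)) as (l3 & _ & N3 & L3 & _).
destruct (qpoch_limit (q ^ 4) (q ^ 5) (Ha 3%nat) (Ha 4%nat)) as (l4 & _ & N4 & L4 & _).
destruct (qpoch_limit (q ^ 5) (q ^ 5) (Ha 4%nat) (Ha 4%nat)) as (l5 & _ & N5 & L5 & _).
assert (E : qq = l1 * l2 * l3 * l4 * l5).
{ apply (Clim_unique (fun n => qpoch q q (5 * n))).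
  - apply (Clim_subseq _ _ (fun n => (5 * n)%nat)); [intros n; lia | exact Lq].
  - eapply Clim_ext; [intros n; symmetry; apply qfact_mod5|].
    repeat apply Clim_mult; assumption. }
rewrite (qpoch_inf_eq _ _ _ Lm), (qpoch_inf_eq _ _ _ L1), (qpoch_inf_eq _ _ _ L2),
  (qpoch_inf_eq _ _ _ L3), (qpoch_inf_eq _ _ _ L4).
split; apply Clim_triple_series.
(* Inside (q;q)_oo the residues 2, 3 and 0 cancel against the triple product, leaving 1 and 4; in
   the second identity 4, 1 and 0 cancel. *)
- replace (qm / (l1 * l4)) with (qm * / qq * (l2 * l3 * l5))
    by (rewrite E; field; auto).
  eapply Clim_ext; [|apply (Clim_triple_sum q (q ^ 2) (q ^ 3) qq qm l2 l3 l5 0)]; auto.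
  + intros N; do 3 (apply csum_ext; intros ? _); apply summand_e1, Hn.
  + ring.
  + apply jacobi_alpha_base_0.
- replace (qm / (l2 * l3)) with (qm * / qq * (l4 * l1 * l5))
    by (rewrite E; field; auto).
  eapply Clim_ext; [|apply (Clim_triple_sum q (q ^ 4) q qq qm l4 l1 l5 1)]; auto.
  + intros N; do 3 (apply csum_ext; intros ? _); apply summand_e2, Hn.
  + ring.
  + apply jacobi_alpha_base_1.
Qed.
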